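(* Let $d>0$ be real and let $n \geq 1$ be an integer. If $E \subset \mathbb{R}^n$ is compact and upper Ahlfors $d$-regular with $\mathcal{H}^d(E)>0$, then $$\liminf_{p\nearrow d} \frac{\operatorname{Cap}_p(E)^p}{d-p} \ge \frac{\mathcal{H}^d(E)^2/d}{\int_E \overline{\sigma}_{d}(\mathcal{H}^d|_E,x) \, d\mathcal{H}^d(x)} .$$
   Context: Riesz energy and capacity: for a nonempty compact set $E\subset\mathbb{R}^n$ and $p>0$, the Riesz $p$-energy is $V_p(E) = \min_\mu \int_E \int_E |x-y|^{-p} \, d\mu(x)\, d\mu(y) \in (0,+\infty]$, where the minimum is over all (Borel) probability measures $\mu$ on $E$ (the minimum is attained, possibly with value $+\infty$). The Riesz $p$-capacity is $\operatorname{Cap}_p(E) = V_p(E)^{-1/p}$, which equals $0$ when $V_p(E)=+\infty$. $\mathcal{H}^d$ is $d$-dimensional Hausdorff measure (when $d$ is an integer, normalized to agree with Lebesgue measure on subsets of $\mathbb{R}^d$; the inequality is unaffected by the choice of normalization), and $\mathcal{H}^d|_E(\cdot)=\mathcal{H}^d(\cdot\cap E)$. $\mathbb{B}^n(x,r)$ is the open ball in $\mathbb{R}^n$ with center $x$ and radius $r$. Upper Ahlfors $d$-regular: a set $A \subset \mathbb{R}^n$ is upper Ahlfors $d$-regular if there is a constant $C>0$ such that $\mathcal{H}^d(\mathbb{B}^n(x,r)\cap A) \leq C r^d$ for all $x \in A$ and $r \in (0,\operatorname{diam} A]$. Second-order upper density at dimension $d$ of a finite Borel measure $\mu$ on $\mathbb{R}^n$: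 $\overline{\sigma}_{d}(\mu, x) = \limsup_{p\nearrow d} \, (d-p) \int_0^1 \mu(\mathbb{B}^n(x,r)) r^{-p-1} \, dr$ for $x\in\mathbb{R}^n$. If the denominator on the right side of the inequality were $0$, the right side is read as $+\infty$. *)

(* Defs.v *)
From HB Require Import structures.
From mathcomp Require Import all_boot all_order all_algebra.
From mathcomp Require Import all_classical all_reals all_analysis.

Set Implicit Arguments.
Unset Strict Implicit.
Unset Printing Implicit Defensive.

Import Order.TTheory GRing.Theory Num.Theory.
Import numFieldNormedType.Exports.

Local Open Scope classical_set_scope.
Local Open Scope ring_scope.

(* The norm `|x| on 'rV[R]_n is the sup norm, hence the explicit Euclidean
   distance below; both induce the same topology, so [open] and [compact] on
   'rV[R]_n are the usual notions. *)

Definition eucl_dist (R : realType) (n : nat) (x y : 'rV[R]_n) : R :=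
  Num.sqrt (\sum_(i < n) (x ord0 i - y ord0 i) ^+ 2).

Definition eucl_ball (R : realType) (n : nat) (x : 'rV[R]_n) (r : R) :
    set 'rV[R]_n :=
  [set y | eucl_dist x y < r].

(* The point 0 gives the empty set diameter 0. *)
Definition diam (R : realType) (n : nat) (A : set 'rV[R]_n) : \bar R :=
  ereal_sup ([set 0%E] `|`
    [set z | exists x y, [/\ A x, A y & z = (eucl_dist x y)%:E]]).

Definition borelRn (R : realType) (n : nat) :=
  g_sigma_algebraType (@open 'rV[R]_n).

Definition Gamma (R : realType) (s : R) : R :=
  \int[@lebesgue_measure R]_(t in `]0, +oo[) (t `^ (s - 1) * expR (- t)).

(* omega_d / 2^d, where omega_d = pi^(d/2) / Gamma(d/2 + 1) is, for integer d,
   the volume of the d-dimensional unit ball; with this factor H^d agrees with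
   Lebesgue measure on R^d. *)
Definition hausdorff_const (R : realType) (d : R) : R :=
  pi `^ (d / 2) / Gamma (d / 2 + 1) / 2 `^ d.

Section Hausdorff.
Local Open Scope ereal_scope.

Definition hausdorff_pre (R : realType) (n : nat) (d delta : R)
    (A : set 'rV[R]_n) : \bar R :=
  ereal_inf [set \sum_(0 <= i <oo) (diam (U i) `^ d) |
    U in [set U : (set 'rV[R]_n)^nat |
      A `<=` \bigcup_i U i /\ forall i, diam (U i) <= delta%:E]].

(* Meant for d > 0: for d = 0 empty sets in a cover would count for 1. *)
Definition hausdorff (R : realType) (n : nat) (d : R) (A : set (borelRn R n)) :
    \bar R :=
  (hausdorff_const d)%:E *
  ereal_sup [set hausdorff_pre d delta A | delta in [set delta | (0 < delta)%R]].

Definition upper_ahlfors_regular (R : realType) (n : nat) (d : R)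
    (A : set 'rV[R]_n) : Prop :=
  exists2 C : R, (0 < C)%R &
    forall (x : 'rV[R]_n) (r : R), A x -> (0 < r)%R -> r%:E <= diam A ->
      hausdorff d (eucl_ball x r `&` A) <= (C * r `^ d)%:E.

End Hausdorff.

Section Riesz.
Local Open Scope ereal_scope.

(* In MathComp 0 `^ (- p) = 0 for p > 0, so the diagonal is set apart. *)
Definition riesz_kernel (R : realType) (n : nat) (p : R) (x y : 'rV[R]_n) :
    \bar R :=
  if x == y then +oo else (eucl_dist x y `^ (- p))%:E.

Definition riesz_energy (R : realType) (n : nat) (p : R)
    (E : set (borelRn R n)) : \bar R :=
  ereal_inf [set \int[mu]_(x in E) \int[mu]_(y in E) riesz_kernel p x y |
    mu in [set mu : probability (borelRn R n) R | mu E = 1]].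

(* V^(-1/p) is written (1/V)^(1/p), so that V = +oo gives 0: in MathComp,
   (+oo)^-1 = 0 but +oo `^ r = +oo also for r < 0. *)
Definition riesz_capacity (R : realType) (n : nat) (p : R)
    (E : set (borelRn R n)) : \bar R :=
  (riesz_energy p E)^-1 `^ p^-1.

Definition upper_density2 (R : realType) (n : nat) (d : R)
    (mu : set (borelRn R n) -> \bar R) (x : 'rV[R]_n) : \bar R :=
  limf_esup (fun p : R => (d - p)%:E *
    \int[@lebesgue_measure R]_(r in `]0%R, 1%R[)
      (mu (eucl_ball x r) * (r `^ (- p - 1))%:E)) d^'-.

End Riesz.

Definition set_restr (R : realType) (n : nat) (mu : set (borelRn R n) -> \bar R)
    (E : set (borelRn R n)) : set (borelRn R n) -> \bar R :=
  fun A => mu (A `&` E).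

(* Main.v *)
Require Import Defs.
From HB Require Import structures.
From mathcomp Require Import all_boot all_order all_algebra.
From mathcomp Require Import all_classical all_reals all_analysis.
From mathcomp Require Import measurable_realfun.
From mathcomp Require Import ring.

Set Implicit Arguments.
Unset Strict Implicit.
Unset Printing Implicit Defensive.

Import Order.TTheory GRing.Theory Num.Theory.
Import numFieldNormedType.Exports.

Local Open Scope classical_set_scope.
Local Open Scope ring_scope.
Local Open Scope ereal_scope.

(* Take the normalized restriction mu of H^d to E as a trial measure
   for the energy. As |x-y|^(-p) <= 1 + p int_0^1 1_{|x-y|<r} r^(-p-1) dr for
   x <> y, Tonelli bounds (d-p) V_p(E) by (d-p) plus p / H^d(E)^2 times the
   integral over E of (d-p) int_0^1 H^d(B(x,r) n E) r^(-p-1) dr. Upper Ahlfors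
   regularity bounds the latter integrand uniformly in p < d and x in E, so a
   reverse Fatou argument as p increases to d yields the second-order upper
   density. That H^d is a measure on Borel sets comes from Caratheodory's
   criterion for metric outer measures. *)

(** * Metric outer measures *)

(** The density is a limsup over a continuum of exponents, so its measurability in x is not
    immediate. Reverse Fatou is therefore run along a sequence of exponents, whose limsup is
    measurable and lies below the density; the two are compared by monotonicity of the integral of
    nonnegative functions, which holds without measurability. The same device handles the Riesz
    kernel. The factor d - p acts twice: it cancels the pole 1/(d - p) of the integral of r^(d-p-1)
    over ]0,1[, which gives the uniform bound, and it sends the constant 1 of the kernel bound to 0.
    The kernel bound fails on the diagonal, where the kernel is infinite; this costs nothing because
    points have H^d-measure 0. Regularity speaks only of radii up to diam E, while the potential
    uses all r < 1. The constant is enlarged to serve every radius, which requires H^d(E) to be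
    finite; compactness provides this. *)

Definition metric_additive (R : realType) (V : normedModType R)
    (mu : set V -> \bar R) :=
  forall (A B : set V) (e : R), (0 < e)%R ->
    (forall x y, A x -> B y -> (e <= `|x - y|)%R) ->
    mu A + mu B <= mu (A `|` B).

(** [A k] is the part of [X] at distance at least 1/(k+1) from the complement of [U], so metric
    additivity applies to [A k] and [X] minus [U]. What [A k] misses of [X] in [U] is a union of
    shells [D]; the series of their measures converges when [mu X] is finite, so the missing part
    tends to 0. *)
Lemma metric_outer_measure_caratheodory (R : realType) (V : normedModType R)
    (mu : {outer_measure set V -> \bar R}) :
  metric_additive mu -> forall U, open U -> mu.-caratheodory U.
Proof.
move=> muD U oU; apply: le_caratheodory_measurable => X.
have [->|Xoo] := eqVneq (mu X) +oo; first by rewrite leey.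
have le_mu (Y Z : set V) : Y `<=` Z -> mu Y <= mu Z.
  by move=> ?; exact: le_outer_measure.
pose A k := X `&` [set x | forall y, ~ U y -> (k.+1%:R^-1 <= `|x - y|)%R].
have AX k : A k `<=` X by move=> x [].
have A_nd k : A k `<=` A k.+1.
  move=> x [Xx Ax]; split=> // y /Ax; apply: le_trans.
  by rewrite lef_pV2 ?posrE ?ler_nat.
pose D k := A k.+1 `\` A k.
have sepA k x z : A k x -> X z -> ~ A k.+1 z ->
    (k.+1%:R^-1 - k.+2%:R^-1 <= `|x - z|)%R.
  move=> [_ Ax] Xz /not_andP[//|/existsNP[y /not_implyP[nUy /negP]]].
  rewrite -ltNge => zy; rewrite lerBlDr (le_trans (Ax _ nUy))//.
  by rewrite (le_trans (ler_distD z _ _))// lerD2l ltW.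
have gap k : (0 < k.+1%:R^-1 - k.+2%:R^-1 :> R)%R.
  by rewrite subr_gt0 ltf_pV2 ?posrE ?ltr_nat.
(* [A m] and [D m.+1] are separated, hence the telescoping. *)
have sumD m : \sum_(0 <= k < m) mu (D k.+1) <= mu (A m) + mu (A m.+1).
  elim: m => [|m ih]; first by rewrite big_nil adde_ge0// outer_measure_ge0.
  rewrite big_nat_recr//= (le_trans (leeD2r _ ih))// addeAC addeC leeD2l//.
  apply: le_trans (muD _ _ _ (gap m) _) _.
    by move=> x z Ax [/AX Xz nz]; exact: (sepA m).
  by apply: le_mu => x [/A_nd/A_nd|[]].
have X2oo : mu X + mu X < +oo by rewrite lte_add_pinfty ?ltey.
have Doo : \sum_(k <oo) mu (D k.+1) < +oo.
  apply: le_lt_trans X2oo; apply: lime_le.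
    by apply: is_cvg_nneseries => *; exact: outer_measure_ge0.
  by apply: nearW => m; rewrite (le_trans (sumD m))// leeD// le_mu.
have cover m : X `&` U `<=` A m.+1 `|` \bigcup_(k in ~` `I_m) D k.+1.
  move=> x [Xx Ux].
  have [N _ AN] : exists2 N, True & A N x.
    have /nbhs_ballP[e /= e0 eU] := open_nbhs_nbhs (conj oU Ux).
    have [N eN] : exists N, (N.+1%:R^-1 < e)%R.
      exists (Num.truncn e^-1); rewrite invf_plt ?posrE//.
      by rewrite truncnS_gt.
    exists N => //; split=> // y nUy; rewrite leNgt; apply/negP => xy.
    by apply: nUy; apply: eU; rewrite -ball_normE/= (lt_trans xy).
  have [Am|nAm] := pselect (A m.+1 x); [by left|right].
  have A_le i j : (i <= j)%N -> A i `<=` A j.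
    move=> /subnKC <-; elim: (j - i)%N => [|k ih]; first by rewrite addn0.
    by rewrite addnS; exact: subset_trans (A_nd _).
  (* The least [k] with x in [A k] is at least m + 2, so x lies in the shell [D (k - 1)]; the union
     is indexed by [k - 2]. *)
  case: (@ex_minnP (fun k => `[< A k x >])) => [|k /asboolP Ak kmin].
    by exists N; exact/asboolP.
  have mk : (m.+1 < k)%N.
    by rewrite ltnNge; apply/negP => /A_le /(_ _ Ak).
  case: k => [//|k] in Ak kmin mk *.
  case: k => [//|k] in Ak kmin mk *.
  exists k => /=; first by apply/negP; rewrite -leqNgt -ltnS.
  split=> // Ak'; have := kmin k.+1 ltac:(exact/asboolP).
  by rewrite ltnn.
have main m : mu (X `&` U) + mu (X `&` ~` U) <=
    mu X + \sum_(m <= k <oo) mu (D k.+1).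
  apply: (@le_trans _ _ (mu (A m.+1) + \sum_(m <= k <oo) mu (D k.+1)
      + mu (X `&` ~` U))).
    rewrite leeD2r// (le_trans (le_mu _ _ (cover m)))//.
    rewrite (le_trans (outer_measureU2 _ _ _))// leeD2l//.
    exact: (outer_measure_sigma_subadditive_tail mu m (fun k => D k.+1)).
  rewrite addeAC leeD2r//.
  (* By definition [A m.+1] keeps distance [m.+2%:R^-1] from the complement of [U]. *)
  apply: le_trans (muD _ _ m.+2%:R^-1%R _ _) _ => //.
    by move=> x y [_ Ax] [_] /Ax.
  by apply: le_mu => x [/AX|[]].
have tail0 : (fun m => mu X + \sum_(m <= k <oo) mu (D k.+1)) @ \oo --> mu X + 0.
  apply: cvgeD; first by rewrite fin_num_adde_defl.
    exact: cvg_cst.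
  by apply: nneseries_tail_cvg => // k _; exact: outer_measure_ge0.
rewrite -[leRHS]adde0 -(cvg_lim _ tail0)//; apply: lime_ge.
  by apply/cvg_ex; eexists; exact: tail0.
by apply: nearW => m; exact: main.
Qed.

(** * Hausdorff measure on Borel sets *)

Section HausdorffMeasure.
Context (R : realType) (n : nat) (d : R).
Hypothesis d0 : (0 < d)%R.
Implicit Types (A B U : set 'rV[R]_n) (delta : R).

Lemma diam_ge0 A : 0 <= diam A.
Proof. by apply: ereal_sup_ubound; left. Qed.

Lemma eucl_dist_le_diam A x y : A x -> A y -> (eucl_dist x y)%:E <= diam A.
Proof. by move=> Ax Ay; apply: ereal_sup_ubound; right; exists x, y. Qed.

Lemma eucl_distxx (x : 'rV[R]_n) : eucl_dist x x = 0%R.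
Proof.
by rewrite /eucl_dist big1 ?sqrtr0// => i _; rewrite subrr expr0n.
Qed.

Lemma diam_subset1 A x : A `<=` [set x] -> diam A = 0.
Proof.
move=> Ax; apply/eqP; rewrite eq_le diam_ge0 andbT.
apply: ge_ereal_sup => _ [->//|[y [z [/Ax -> /Ax -> ->]]]].
by rewrite eucl_distxx.
Qed.

Lemma diam_set0 : diam (@set0 'rV[R]_n) = 0.
Proof. by apply: (@diam_subset1 _ (0%R : 'rV[R]_n)). Qed.

Lemma norm_le_eucl_dist (x y : 'rV[R]_n) : (`|x - y| <= eucl_dist x y)%R.
Proof.
rewrite [leLHS]/Num.norm /= mx_normrE; apply: bigmax_le => [|[i j] _] /=;
  first exact: sqrtr_ge0.
rewrite !ord1 !mxE -sqrtr_sqr ler_wsqrtr// (bigD1 j)//= lerDl.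
by apply: sumr_ge0 => k _; exact: sqr_ge0.
Qed.

(** The bound on diameters is moved into the weight: sets that are too large cost [+oo]. Over the
    sigma-algebra of all subsets, [mu_ext] of this weight is then [hausdorff_pre], which inherits
    its countable subadditivity. *)
Let gauge delta (U : set (g_sigma_algebraType [set: set 'rV[R]_n])) : \bar R :=
  if diam (U : set 'rV[R]_n) <= delta%:E then diam U `^ d else +oo.

Let gauge_ge0 delta U : 0 <= gauge delta U.
Proof. by rewrite /gauge; case: ifP => // _; exact: poweR_ge0. Qed.

Let hausdorff_preE delta A : hausdorff_pre d delta A = mu_ext (gauge delta) A.
Proof.
apply/eqP; rewrite eq_le; apply/andP; split.
- apply: le_ereal_inf_tmp => _ [U [_ AU] <-].
  have [dU|/existsNP[i /negP dU]] := pselect (forall i, diam (U i) <= delta%:E).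
    apply: ereal_inf_lbound; exists U => //.
    by apply: eq_eseriesr => i _; rewrite /gauge dU.
  rewrite (nneseries_pinfty (k := i)) ?leey//.
  by rewrite /gauge (negbTE dU).
- apply: le_ereal_inf_tmp => _ [U [AU dU] <-].
  apply: ereal_inf_lbound; exists U.
    by split=> // i; exact: sub_sigma_algebra.
  by apply: eq_eseriesr => i _; rewrite /gauge dU.
Qed.

Let gauge0 delta : (0 < delta)%R -> gauge delta set0 = 0.
Proof.
by move=> /ltW ?; rewrite /gauge diam_set0 lee_fin ifT// poweR0r// gt_eqF.
Qed.

Lemma hausdorff_pre_ge0 delta A : 0 <= hausdorff_pre d delta A.
Proof. by rewrite hausdorff_preE; exact: mu_ext_ge0. Qed.

Lemma le_hausdorff_pre delta A B : A `<=` B ->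
  hausdorff_pre d delta A <= hausdorff_pre d delta B.
Proof. by move=> AB; rewrite !hausdorff_preE;
  exact: (le_mu_ext (gauge delta) AB). Qed.

Lemma hausdorff_pre0 delta : (0 < delta)%R ->
  hausdorff_pre d delta (set0 : set 'rV[R]_n) = 0.
Proof. by move=> ?; rewrite hausdorff_preE mu_ext0// gauge0. Qed.

Lemma hausdorff_pre_le_diam delta A : (0 < delta)%R ->
  diam A <= delta%:E -> hausdorff_pre d delta A <= diam A `^ d.
Proof.
move=> dl0 dA; apply: ereal_inf_lbound.
exists (fun i => if i == 0%N then A else set0) => /=.
  split; first by move=> x Ax; exists 0%N.
  by case=> [//|i]; rewrite diam_set0 lee_fin ltW.
rewrite nneseries_recl//; last by move=> *; exact: poweR_ge0.
rewrite eseries_cond/= eseries0 ?adde0// => -[|]//= k _ _.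
by rewrite diam_set0 poweR0r// gt_eqF.
Qed.

Lemma hausdorff_pre_le delta delta' A : (delta <= delta')%R ->
  hausdorff_pre d delta' A <= hausdorff_pre d delta A.
Proof.
move=> dd; apply: ereal_inf_le_tmp => _ [U [AU dU] <-]; exists U => //.
by split=> // i; rewrite (le_trans (dU i))// lee_fin.
Qed.

Lemma hausdorff_const_ge0 : (0 <= hausdorff_const d)%R.
Proof.
rewrite /hausdorff_const !divr_ge0 ?powR_ge0//.
by apply: Rintegral_ge0 => t _; rewrite mulr_ge0 ?powR_ge0 ?expR_ge0.
Qed.

(** The outer measure without its normalizing constant, taken on all subsets as Caratheodory's
    criterion requires. *)
Definition hausdorff0 (A : set 'rV[R]_n) : \bar R :=
  ereal_sup [set hausdorff_pre d delta A | delta in [set delta |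
    (0 < delta)%R]].

Lemma hausdorff_pre_le0 delta A : (0 < delta)%R ->
  hausdorff_pre d delta A <= hausdorff0 A.
Proof. by move=> ?; apply: ereal_sup_ubound; exists delta. Qed.

Lemma hausdorff0_ge0 A : 0 <= hausdorff0 A.
Proof. by rewrite (le_trans _ (hausdorff_pre_le0 A ltr01))//
  hausdorff_pre_ge0. Qed.

Let hausdorff00 : hausdorff0 set0 = 0.
Proof.
apply/eqP; rewrite eq_le hausdorff0_ge0 andbT.
by apply: ge_ereal_sup => _ [dl /= dl0 <-]; rewrite hausdorff_pre0.
Qed.

Let le_hausdorff0 : {homo hausdorff0 : A B / A `<=` B >-> A <= B}.
Proof.
move=> A B AB; apply: ge_ereal_sup => _ [dl /= dl0 <-].
by rewrite (le_trans (le_hausdorff_pre dl AB))// hausdorff_pre_le0.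
Qed.

Let hausdorff0_sigma_subadditive : sigma_subadditive hausdorff0.
Proof.
move=> F; apply: ge_ereal_sup => _ [dl /= dl0 <-].
have := @mu_ext_sigma_subadditive _ _ _ (gauge dl) (gauge_ge0 dl) F.
rewrite -hausdorff_preE => /le_trans; apply.
apply: lee_nneseries => [k _ _|k _];
  first by rewrite -hausdorff_preE hausdorff_pre_ge0.
by rewrite -hausdorff_preE hausdorff_pre_le0.
Qed.

HB.instance Definition _ := isOuterMeasure.Build R 'rV[R]_n hausdorff0
  hausdorff00 hausdorff0_ge0 le_hausdorff0 hausdorff0_sigma_subadditive.

(* A set of diameter less than the separation of [A] and [B] meets at most one
   of them, so a fine cover of the union splits into covers of [A] and [B]. *)
Let hausdorff_pre_separated delta A B : (0 < delta)%R ->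
  (forall x y, A x -> B y -> (delta < `|x - y|)%R) ->
  hausdorff_pre d delta A + hausdorff_pre d delta B <=
  hausdorff_pre d delta (A `|` B).
Proof.
move=> dl0 sepAB; apply: le_ereal_inf_tmp => _ [U [ABU dU] <-].
pose V i := if `[< exists x, U i x /\ A x >] then U i else set0.
pose W i := if `[< exists x, U i x /\ A x >] then set0 else U i.
apply: (@le_trans _ _ (\sum_(0 <= i <oo) (diam (V i) `^ d) +
                       \sum_(0 <= i <oo) (diam (W i) `^ d))).
  apply: leeD; apply: ereal_inf_lbound => /=.
    exists V => //; split=> [x Ax|i].
      have [//|i _ Ui] := ABU x; first by left.
      by exists i => //; rewrite /V ifT//; apply/asboolP; exists x.
    by rewrite /V; case: ifP => // _; rewrite diam_set0 lee_fin ltW.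
  exists W => //; split=> [x Bx|i].
    have [//|i _ Ui] := ABU x; first by right.
    exists i => //; rewrite /W ifF//; apply/asboolP => -[y [Uy Ay]].
    have := sepAB _ _ Ay Bx; apply/negP; rewrite -leNgt.
    rewrite (le_trans (norm_le_eucl_dist _ _))// -lee_fin (le_trans _ (dU i))//.
    exact: eucl_dist_le_diam.
  by rewrite /W; case: ifP => // _; rewrite diam_set0 lee_fin ltW.
rewrite -nneseriesD; [|by move=> *; exact: poweR_ge0..].
apply: lee_nneseries => i _; first by rewrite adde_ge0// poweR_ge0.
by rewrite /V /W; case: ifP => _;
  rewrite diam_set0 poweR0r ?gt_eqF// ?adde0 ?add0e.
Qed.

(** The two suprema over scales are taken one after the other, so [key] allows independent scales
    [a] and [b]; both are lowered to a common [c], which only increases the premeasures. Infinite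
    values are set apart because each supremum is reached by subtracting the other term. *)
Let hausdorff0_metric : @metric_additive R 'rV[R]_n hausdorff0.
Proof.
move=> A B e e0 sepAB.
have key a b : (0 < a)%R -> (0 < b)%R ->
    hausdorff_pre d a A + hausdorff_pre d b B <= hausdorff0 (A `|` B).
  (* The half of [e] makes the separation strictly larger than [c]. *)
  move=> a0 b0; pose c := Num.min (Num.min a b) (e / 2)%R.
  have c0 : (0 < c)%R by rewrite !lt_min a0 b0 divr_gt0.
  apply: le_trans (hausdorff_pre_le0 _ c0).
  apply: le_trans (hausdorff_pre_separated c0 _).
    by apply: leeD; apply: hausdorff_pre_le; rewrite !ge_min lexx ?orbT.
  move=> x y Ax By; apply: lt_le_trans (sepAB _ _ Ax By).
  by rewrite gt_min ltr_pdivrMr// ltr_pMr// ltr1n orbT.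
have keyA b : (0 < b)%R ->
    hausdorff0 A + hausdorff_pre d b B <= hausdorff0 (A `|` B).
  move=> b0; have [Boo|Boo] := eqVneq (hausdorff_pre d b B) +oo.
    have := key 1%R b ltr01 b0; rewrite Boo addey ?addey// ?gt_eqF//.
      by rewrite (lt_le_trans ltNy0)// hausdorff0_ge0.
    by rewrite (lt_le_trans ltNy0)// hausdorff_pre_ge0.
  have Bfin : hausdorff_pre d b B \is a fin_num.
    by rewrite ge0_fin_numE ?ltey// hausdorff_pre_ge0.
  rewrite -leeBrDr//; apply: ge_ereal_sup => _ [a /= a0 <-].
  by rewrite leeBrDr//; exact: key.
have [Aoo|Aoo] := eqVneq (hausdorff0 A) +oo.
  have := keyA 1%R ltr01; rewrite Aoo addye ?addye// ?gt_eqF//.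
    by rewrite (lt_le_trans ltNy0)// hausdorff0_ge0.
  by rewrite (lt_le_trans ltNy0)// hausdorff_pre_ge0.
have Afin : hausdorff0 A \is a fin_num.
  by rewrite ge0_fin_numE ?ltey// hausdorff0_ge0.
rewrite addeC -leeBrDr//; apply: ge_ereal_sup => _ [a /= a0 <-].
by rewrite leeBrDr// addeC; exact: keyA.
Qed.

Lemma borel_caratheodory (A : set (borelRn R n)) :
  measurable A -> hausdorff0.-caratheodory A.
Proof.
move: A; apply: smallest_sub => [|U oU].
  split; [exact: caratheodory_measurable_set0| |exact:
    caratheodory_measurable_bigcup].
  by move=> B mB; rewrite setTD; exact: caratheodory_measurable_setC.
exact: metric_outer_measure_caratheodory hausdorff0_metric _ oU.
Qed.

Lemma hausdorff_ge0 (A : set (borelRn R n)) : 0 <= hausdorff d A.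
Proof. by rewrite mule_ge0 ?hausdorff0_ge0// lee_fin hausdorff_const_ge0. Qed.

Lemma hausdorff_set0 : hausdorff d (set0 : set (borelRn R n)) = 0.
Proof. by rewrite /hausdorff -/(hausdorff0 _) outer_measure0 mule0. Qed.

Lemma le_hausdorff (A B : set (borelRn R n)) : A `<=` B ->
  hausdorff d A <= hausdorff d B.
Proof.
move=> AB; apply: lee_wpmul2l; first by rewrite lee_fin hausdorff_const_ge0.
exact: (le_hausdorff0 AB).
Qed.

(** At every scale the set covers itself at cost 0^d, which is 0 since d > 0. Applied to points,
    this removes the diagonal of the energy; applied to [E], it shows that [E] has positive
    diameter. *)
Lemma hausdorff_diam0 (A : set (borelRn R n)) :
  diam (A : set 'rV[R]_n) = 0 -> hausdorff d A = 0.
Proof.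
move=> dA; rewrite /hausdorff -/(hausdorff0 _).
suff -> : hausdorff0 A = 0 by rewrite mule0.
apply/eqP; rewrite eq_le hausdorff0_ge0 andbT.
apply: ge_ereal_sup => _ [dl /= dl0 <-].
have := @hausdorff_pre_le_diam dl A dl0.
by rewrite dA poweR0r ?gt_eqF// => ->//; rewrite lee_fin ltW.
Qed.

Lemma hausdorff_setU_le (A B : set (borelRn R n)) :
  hausdorff d (A `|` B) <= hausdorff d A + hausdorff d B.
Proof.
rewrite /hausdorff -!/(hausdorff0 _) -ge0_muleDr ?hausdorff0_ge0//.
apply: lee_wpmul2l; first by rewrite lee_fin hausdorff_const_ge0.
exact: outer_measureU2.
Qed.

Lemma hausdorff_semi_sigma_additive :
  semi_sigma_additive (hausdorff d : set (borelRn R n) -> \bar R).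
Proof.
move=> F mF tF mUF.
have := @caratheodory_measure_sigma_additive _ _ hausdorff0 F
  (fun i => borel_caratheodory (mF i)) tF (borel_caratheodory mUF).
move=> /cvgeZl -/(_ (hausdorff_const d)%:E isT).
apply: cvg_trans; apply: near_eq_cvg; apply: nearW => m /=.
by rewrite ge0_sume_distrr// => i _; exact: hausdorff0_ge0.
Qed.

End HausdorffMeasure.

(** The proof of [0 < d] is an argument so that a measure structure, whose laws rely on it, can be
    attached to the name. *)
Definition hausdorff_measure (R : realType) (n : nat) (d : R)
  of (0 < d)%R : set (borelRn R n) -> \bar R := hausdorff d.

Section HausdorffMeasureInstance.
Context (R : realType) (n : nat) (d : R) (d0 : (0 < d)%R).

HB.instance Definition _ := isMeasure.Build _ (borelRn R n) R
  (@hausdorff_measure R n d d0) (@hausdorff_set0 R n d d0) (hausdorff_ge0 d)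
  (@hausdorff_semi_sigma_additive R n d d0).

End HausdorffMeasureInstance.

(** * The truncated potential *)

Lemma continuous_powR_gt0 (R : realType) (a x : R) : (0 < x)%R ->
  {for x, continuous (@powR R ^~ a)}.
Proof.
move=> x0; apply: differentiable_continuous; apply/derivable1_diffP.
by apply: derivable_powR; rewrite in_itv/= x0.
Qed.

(** Either sign of [a] occurs: a = -p in the kernel bound, a = d - p in the growth bound. *)
Lemma integral_powR_cc (R : realType) (a s : R) : a != 0%R -> (0 < s < 1)%R ->
  \int[@lebesgue_measure R]_(r in `[s, 1%R]) (r `^ (a - 1))%:E =
  ((1 - s `^ a) / a)%:E.
Proof.
move=> a0 /andP[s0 s1].
rewrite (@continuous_FTC2 R _ (fun r => r `^ a / a)%R s 1%R)//.
- by rewrite -EFinB powR1 mulrBl.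
- apply: continuous_in_subspaceT => r; rewrite inE/= in_itv/= => /andP[sr _].
  by apply: continuous_powR_gt0; exact: lt_le_trans sr.
- split.
  + move=> r; rewrite in_itv/= => /andP[sr _]; apply: derivableM => //.
    by apply: derivable_powR; rewrite in_itv/= (lt_trans s0).
  + apply: cvgMl; apply: cvg_at_right_filter.
    exact: continuous_powR_gt0.
  + apply: cvgMl; apply: cvg_at_left_filter.
    exact: continuous_powR_gt0.
- move=> r; rewrite in_itv/= => /andP[sr _].
  have r0 : r \in `]0%R, +oo[ by rewrite in_itv/= (lt_trans s0).
  rewrite derive1Mr; last exact: derivable_powR.
  by rewrite powR_derive1// mulrAC divff// mul1r.
Qed.

Lemma integral_powR_oo (R : realType) (a : R) : (0 < a)%R ->
  \int[@lebesgue_measure R]_(r in `]0%R, 1%R[) (r `^ (a - 1))%:E <= (a^-1)%:E.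
Proof.
(* Monotone convergence along intervals that avoid the singularity at 0; the shift to [k.+2] keeps
   the left endpoint below 1. *)
move=> a0; pose A k : set (measurableTypeR R) := `]k.+2%:R^-1%R, 1%R[%classic.
have UA : \bigcup_k A k = `]0%R, 1%R[%classic.
  apply/seteqP; split => [r [k _]|r]; rewrite /A /= !in_itv/= => /andP[lo hi].
    by rewrite hi andbT (lt_trans _ lo)// invr_gt0.
  exists (Num.truncn r^-1) => //=; rewrite in_itv/= hi andbT.
  rewrite invf_plt ?posrE// (lt_trans (truncnS_gt _))//.
  by rewrite ltr_nat.
rewrite -UA.
have mf B : measurable_fun B (fun r : measurableTypeR R => (r `^ (a - 1))%:E).
  by apply/measurable_EFinP; apply: measurable_funTS; exact: measurable_powR.
have ndA : nondecreasing_seq A.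
  move=> i j ij; apply/subsetPset => r; rewrite /A /= !in_itv/= => /andP[lo ->].
  by rewrite andbT (le_lt_trans _ lo)// lef_pV2 ?posrE// ler_nat !ltnS.
have f0 i (r : measurableTypeR R) : A i r -> 0 <= (r `^ (a - 1))%:E.
  by rewrite lee_fin powR_ge0.
have mA i : measurable (A i) by exact: measurable_itv.
have cvgA := ge0_nondecreasing_set_cvg_integral
  (mu := @lebesgue_measure R) ndA mA
  (fun i => mf _) f0.
rewrite -(cvg_lim _ cvgA)//; apply: lime_le; first by apply/cvg_ex; eexists;
  exact: cvgA.
apply: nearW => k; rewrite /A -(@integral_itv_bndoo _ _ _ _ true false);
  last exact: mf.
rewrite integral_powR_cc ?gt_eqF//;
  last by rewrite invr_gt0 ltr0n invf_lt1// ltr1n.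
by rewrite lee_fin ler_pdivrMr// mulVf ?gt_eqF// gerBl powR_ge0.
Qed.

(** The integral of a nonnegative function is a supremum over the simple functions below it, and a
    larger function has more of them. *)
Lemma ge0_le_integral_nonmeasurable d (T : measurableType d) (R : realType)
    (mu : {measure set T -> \bar R}) (D : set T) (f g : T -> \bar R) :
  (forall x, D x -> 0 <= f x) -> (forall x, D x -> f x <= g x) ->
  \int[mu]_(x in D) f x <= \int[mu]_(x in D) g x.
Proof.
move=> f0 fg; have g0 x : D x -> 0 <= g x.
  by move=> Dx; rewrite (le_trans (f0 _ Dx))// fg.
rewrite !ge0_integralE//; apply: ereal_sup_le => _ [h /= hf <-]; exists h => //.
move=> x; rewrite (le_trans (hf x))// /patch; case: ifPn => // xD.
by apply: fg; exact: set_mem.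
Qed.

(** * Borel measurability of the Euclidean distance and balls *)

Section EuclMeasurable.
Context (R : realType) (n : nat).

Lemma borel_closed (A : set 'rV[R]_n) :
  closed A -> measurable (A : set (borelRn R n)).
Proof.
move=> cA; rewrite -(setCK A); apply: measurableC.
by apply: sub_sigma_algebra; exact: closed_openC.
Qed.

Lemma measurable_coord (i : 'I_n) :
  measurable_fun setT (fun x : borelRn R n => x ord0 i : R).
Proof.
apply: (measurability _ (RGenOpens.measurableE R)).
move=> _ [_ [a [b ->] <-]]; rewrite setTI; apply: sub_sigma_algebra.
by apply: open_comp; [move=> x _; exact: coord_continuous|exact: interval_open].
Qed.

Lemma measurable_eucl_dist d (T : measurableType d) (f g : T -> borelRn R n) :
  measurable_fun setT f -> measurable_fun setT g ->
  measurable_fun setT (fun z => eucl_dist (f z) (g z)).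
Proof.
move=> mf mg;
  apply: (measurableT_comp (continuous_measurable_fun (@sqrt_continuous R))).
apply: measurable_sum => i; apply: measurable_funX.
by apply: measurable_funB; apply: (measurableT_comp (measurable_coord i)).
Qed.

Lemma measurable_eucl_ball (x : borelRn R n) (r : R) :
  measurable (eucl_ball x r : set (borelRn R n)).
Proof.
have mdist : measurable_fun setT (fun y : borelRn R n => eucl_dist x y).
  exact: measurable_eucl_dist.
have := mdist measurableT `]-oo, r[%classic (measurable_itv _).
by rewrite setTI.
Qed.

End EuclMeasurable.

Section TruncatedPotential.
Context (R : realType) (n : nat) (nu : {finite_measure set
  (borelRn R n) -> \bar R}).

Definition radial_weight (p : R)
  (z : borelRn R n * measurableTypeR R) : \bar R :=
  nu (eucl_ball z.1 z.2) * (z.2 `^ (- p - 1))%:E.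

(** By the layer-cake formula, [p] times this is the integral of |x-y|^(-p) - 1 over the unit ball
    around [x]. *)
Definition truncated_potential (p : R) (x : borelRn R n) : \bar R :=
  \int[@lebesgue_measure R]_(r in `]0%R, 1%R[) radial_weight p (x, r).

Lemma radial_weight_ge0 p z : 0 <= radial_weight p z.
Proof. by rewrite mule_ge0// lee_fin powR_ge0. Qed.

Lemma truncated_potential_ge0 p x : 0 <= truncated_potential p x.
Proof. by apply: integral_ge0 => r _; exact: radial_weight_ge0. Qed.

Let dist_lt : set ((borelRn R n * measurableTypeR R) * borelRn R n) :=
  [set z | (eucl_dist z.1.1 z.2 < z.1.2)%R].

Let measurable_dist_lt : measurable dist_lt.
Proof.
have mf : measurable_fun setT (fun z :
  (borelRn R n * measurableTypeR R) * borelRn R n =>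
    z.1.2 - eucl_dist z.1.1 z.2)%R.
  apply: measurable_funB.
    exact: (measurableT_comp measurable_snd measurable_fst).
  apply: measurable_eucl_dist; last exact: measurable_snd.
  exact: (measurableT_comp measurable_fst measurable_fst).
have := mf measurableT `]0%R, +oo[%classic (measurable_itv _).
rewrite setTI; congr measurable; apply/seteqP.
by split=> y /=; rewrite in_itv/= andbT subr_gt0.
Qed.

(** The balls are the sections of the measurable set [dist_lt] at the pairs (x, r), and the
    [nu]-measure of a section is measurable in its parameter. *)
Lemma measurable_radial_weight p : measurable_fun setT (radial_weight p).
Proof.
apply: emeasurable_funM.
  have := @measurable_fun_xsection _ _ _ _ _ nu _ measurable_dist_lt.
  congr measurable_fun; apply/funext => z /=; congr (nu _).
  by apply/seteqP; split => y; rewrite /xsection /= inE.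
apply/measurable_EFinP.
have mpow : measurable_fun (setT : set (measurableTypeR R))
    (fun r => (r : R) `^ (- p - 1))%R by exact: measurable_powR.
exact: (measurableT_comp mpow measurable_snd).
Qed.

Lemma measurable_truncated_potential p :
  measurable_fun setT (truncated_potential p).
Proof.
pose D : set (borelRn R n * measurableTypeR R) := setT `*` `]0%R, 1%R[%classic.
have mD : measurable D by exact: measurableX.
have := @measurable_fun_fubini_tonelli_F _ _ _ _ _ (@lebesgue_measure R)
  (radial_weight p \_ D).
rewrite (_ : fubini_F _ _ = truncated_potential p).
  apply; last by move=> z; apply: erestrict_ge0 => y _;
    exact: radial_weight_ge0.
  apply/(measurable_restrictT _ mD); apply: measurable_funTS.
  exact: measurable_radial_weight.
apply/funext => x; rewrite /fubini_F /truncated_potential [RHS]integral_mkcond.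
apply: eq_integral => r _; rewrite /patch /D.
congr (if _ then _ else _); apply/idP/idP; rewrite !inE //=.
by move=> [].
Qed.

Lemma truncated_potential_le (p a C : R) x : (p < a)%R -> (0 <= C)%R ->
  (forall r, (0 < r < 1)%R -> nu (eucl_ball x r) <= (C * r `^ a)%:E) ->
  truncated_potential p x <= (C / (a - p))%:E.
Proof.
move=> pa C0 nuC.
have ap0 : (0 < a - p)%R by rewrite subr_gt0.
apply: (@le_trans _ _ (\int[@lebesgue_measure R]_(r in `]0%R, 1%R[)
    (C%:E * (r `^ (a - p - 1))%:E))).
  apply: ge0_le_integral_nonmeasurable => r; first by move=> _;
    exact: radial_weight_ge0.
  rewrite /= in_itv/= => /andP[r0 r1].
  rewrite /radial_weight /= (_ : a - p - 1 = a + (- p - 1))%R;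
    last by rewrite addrA.
  rewrite powRD; last by rewrite (gt_eqF r0) implybT.
  rewrite -EFinM mulrA EFinM; apply: lee_wpmul2r;
    first by rewrite lee_fin powR_ge0.
  by apply: nuC; rewrite r0 r1.
rewrite ge0_integralZl//; last 2 first.
- by apply/measurable_EFinP; apply: measurable_funTS; exact: measurable_powR.
- by move=> r _; rewrite lee_fin powR_ge0.
by rewrite EFinM lee_wpmul2l ?lee_fin// integral_powR_oo.
Qed.

(** With s = |x-y|, the right side equals s^(-p) when s < 1, because the integral runs over r > s
    and gives (s^(-p) - 1)/p. When s >= 1, already s^(-p) <= 1. *)
Lemma riesz_kernel_le (p : R) (x y : 'rV[R]_n) : (0 < p)%R -> x != y ->
  riesz_kernel p x y <= 1 + p%:E *
    \int[@lebesgue_measure R]_(r in `]0%R, 1%R[)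
      ((\1_(eucl_ball x r) y)%:E * (r `^ (- p - 1))%:E).
Proof.
move=> p0 xy; rewrite /riesz_kernel (negbTE xy); set s := eucl_dist x y.
have s0 : (0 < s)%R.
  by rewrite (lt_le_trans _ (norm_le_eucl_dist _ _))// normr_gt0 subr_eq0.
have int0 (D : set R) : 0 <= \int[@lebesgue_measure R]_(r in D)
      ((\1_(eucl_ball x r) y)%:E * (r `^ (- p - 1))%:E).
  by apply: integral_ge0 => r _; rewrite -EFinM lee_fin mulr_ge0// powR_ge0.
have [s1|s1] := leP 1%R s.
  rewrite (@le_trans _ _ 1)// ?leeDl ?mule_ge0// ?lee_fin ?(ltW p0)//.
  rewrite powRN invf_le1 ?powR_gt0//.
  have := @ge0_ler_powR R p (ltW p0) 1%R s; rewrite powR1 !nnegrE.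
  by apply => //; exact: ltW.
have -> : \int[@lebesgue_measure R]_(r in `]0%R, 1%R[)
      ((\1_(eucl_ball x r) y)%:E * (r `^ (- p - 1))%:E) =
    \int[@lebesgue_measure R]_(r in `]s, 1%R[) (r `^ (- p - 1))%:E.
  rewrite integral_mkcond [RHS]integral_mkcond; apply: eq_integral => r _.
  rewrite /patch !mem_setE !in_itv/= indicE.
  rewrite (_ : (y \in eucl_ball x r) = (s < r)%R); last first.
    by apply/idP/idP; rewrite inE.
  have [r1|r1] := ltP r 1%R; last by rewrite !andbF.
  rewrite !andbT; case: (ltP s r) => sr /=.
    by rewrite (lt_trans s0 sr) mul1e.
  by rewrite mul0e; case: ifP.
rewrite -(@integral_itv_bndoo _ _ _ _ true false); last first.
  by apply/measurable_EFinP; apply: measurable_funTS; exact: measurable_powR.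
rewrite integral_powR_cc ?oppr_eq0 ?gt_eqF ?s0 ?s1//.
rewrite -EFinM -EFinD lee_fin invrN mulrN mulrN mulrCA divff ?gt_eqF// mulr1.
by rewrite opprB addrC subrK.
Qed.

Lemma integral_riesz_kernel_le (p : R) (x : borelRn R n) : (0 < p)%R ->
  nu [set x] = 0 ->
  \int[nu]_y riesz_kernel p x y <= nu setT + p%:E * truncated_potential p x.
Proof.
move=> p0 nux; pose w (y : borelRn R n) (r : measurableTypeR R) : \bar R :=
  (\1_(eucl_ball x r) y)%:E * (r `^ (- p - 1))%:E.
have w0 y r : 0 <= w y r by rewrite /w -EFinM lee_fin mulr_ge0// powR_ge0.
pose D : set (borelRn R n * measurableTypeR R) := setT `*` `]0%R, 1%R[%classic.
pose f := (fun z => w z.1 z.2) \_ D.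
have mD : measurable D by exact: measurableX.
have f0 z : 0 <= f z by apply: erestrict_ge0.
have mw : measurable_fun setT (fun z : borelRn R n * measurableTypeR R =>
  w z.1 z.2).
  apply: emeasurable_funM; apply/measurable_EFinP.
    have mB : measurable [set z : borelRn R n * measurableTypeR R |
        (eucl_dist x z.1 < z.2)%R].
      have mg : measurable_fun setT (fun z : borelRn R n * measurableTypeR R =>
          z.2 - eucl_dist x z.1)%R.
        apply: measurable_funB; first exact: measurable_snd.
        by apply: measurable_eucl_dist;
          [exact: measurable_cst|exact: measurable_fst].
      have := mg measurableT `]0%R, +oo[%classic (measurable_itv _).
      rewrite setTI; congr measurable; apply/seteqP.
      by split=> y /=; rewrite in_itv/= andbT subr_gt0.
    have := @measurable_indic _ _ R setT _ mB.
    by congr measurable_fun.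
  have mpow : measurable_fun (setT : set (measurableTypeR R))
      (fun r => (r : R) `^ (- p - 1))%R by exact: measurable_powR.
  exact: (measurableT_comp mpow measurable_snd).
have mf : measurable_fun setT f.
  by apply/(measurable_restrictT _ mD); exact: measurable_funTS.
have fE y : \int[@lebesgue_measure R]_(r in `]0%R, 1%R[) w y r =
    \int[@lebesgue_measure R]_r f (y, r).
  rewrite integral_mkcond; apply: eq_integral => r _; rewrite /f /patch /D.
  by congr (if _ then _ else _); apply/idP/idP; rewrite !inE //=; move=> [].
have mF : measurable_fun setT (fun y => \int[@lebesgue_measure R]_r f (y, r)).
  exact: (@measurable_fun_fubini_tonelli_F _ _ _ _ _ (@lebesgue_measure R) f).
have F0 y : 0 <= \int[@lebesgue_measure R]_r f (y, r) by exact: integral_ge0.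
have mx : measurable ([set x] : set (borelRn R n)).
  apply: borel_closed; apply: (@accessible_closed_set1 'rV[R]_n).
  by apply: hausdorff_accessible; exact: norm_hausdorff.
(* The summand [+oo * \1_[set x]] makes the kernel bound valid at y = x too; its integral is
   [+oo * 0 = 0] because [x] is not an atom. *)
apply: (@le_trans _ _ (\int[nu]_y (1 + p%:E * (\int[@lebesgue_measure R]_r f
  (y, r))
    + +oo * (\1_[set x] y)%:E))).
  apply: ge0_le_integral_nonmeasurable => y _.
    by rewrite /riesz_kernel; case: ifP => // _; rewrite lee_fin powR_ge0.
  rewrite -fE; have [<-|xy] := eqVneq x y.
    rewrite indicE mem_set// mule1 addey ?leey// gt_eqF//.
    by rewrite (lt_le_trans ltNy0)// adde_ge0// mule_ge0 ?lee_fin ?(ltW p0)//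
      integral_ge0.
  rewrite indicE memNset ?mule0 ?adde0; last by move/esym/eqP; apply/negP.
  exact: riesz_kernel_le.
have pF0 y : 0 <= p%:E * \int[@lebesgue_measure R]_r f (y, r).
  by rewrite mule_ge0// lee_fin ltW.
have mpF : measurable_fun setT (fun y =>
  p%:E * \int[@lebesgue_measure R]_r f (y, r)).
  by apply: emeasurable_funM => //; exact: measurable_cst.
have mind : measurable_fun setT (fun y : borelRn R n => (\1_[set x] y : R)%:E).
  by apply/measurable_EFinP; exact: measurable_indic.
have moo : measurable_fun setT
    (fun y : borelRn R n => +oo * (\1_[set x] y : R)%:E).
  by apply: emeasurable_funM => //; exact: measurable_cst.
have oo0 y : 0 <= +oo * (\1_[set x] y : R)%:E by rewrite mule_ge0// lee_fin.
have m1F : measurable_fun setT (fun y =>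
  1 + p%:E * \int[@lebesgue_measure R]_r f (y, r)).
  by apply: emeasurable_funD => //; exact: measurable_cst.
have F10 y : 0 <= 1 + p%:E * \int[@lebesgue_measure R]_r f (y,
  r) by rewrite adde_ge0.
rewrite ge0_integralD//.
rewrite [X in _ + X](_ : _ = 0) ?adde0; last first.
  rewrite ge0_integralZl//.
  rewrite integral_indic// setIT; transitivity ((+oo : \bar R) * 0).
    by congr (_ * _); exact: nux.
  exact: mule0.
rewrite ge0_integralD// integral_cst// mul1e leeD2l// ge0_integralZl//;
  last first.
  by rewrite lee_fin ltW.
rewrite lee_wpmul2l ?lee_fin ?(ltW p0)//.
(* After the exchange, the inner integral over y of the indicator is the measure of the ball of
   radius r. *)
rewrite (fubini_tonelli f)//.
rewrite /truncated_potential [leRHS]integral_mkcond le_eqVlt; apply/orP; left.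
apply/eqP/eq_integral => r _; rewrite /f /patch /D.
case: ifPn => r01; last first.
  apply: integral0_eq => y _; rewrite ifF//; apply/negbTE; apply: contraNN r01.
  by rewrite !inE => -[].
transitivity (\int[nu]_y ((r `^ (- p - 1))%:E * (\1_(eucl_ball x r) y)%:E)).
  apply: eq_integral => y _; rewrite ifT; first by rewrite /w muleC.
  by move: r01; rewrite !inE => r01; split.
rewrite ge0_integralZl//; last 2 first.
- by apply/measurable_EFinP/measurable_indic; exact: measurable_eucl_ball.
- by rewrite lee_fin powR_ge0.
rewrite integral_indic ?setIT//; last exact: measurable_eucl_ball.
by rewrite /radial_weight muleC.
Qed.

End TruncatedPotential.

(** * Ahlfors regular compact sets *)

Section AhlforsRegularCompact.
Context (R : realType) (n : nat) (d : R) (E : set 'rV[R]_n).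
Hypotheses (d0 : (0 < d)%R) (cE : compact E) (arE : upper_ahlfors_regular d E).
Hypothesis HE0 : 0 < hausdorff d E.

Lemma eucl_dist_le_norm (x y : 'rV[R]_n) :
  (eucl_dist x y <= Num.sqrt n%:R * `|x - y|)%R.
Proof.
rewrite /eucl_dist -[leRHS]ger0_norm ?mulr_ge0//.
rewrite -sqrtr_sqr exprMn sqr_sqrtr// ler_wsqrtr//.
rewrite -[X in (_ <= X%:R * _)%R](card_ord n) mulr_natl -sumr_const.
apply: ler_sum => i _; rewrite -[leLHS]ger0_norm ?sqr_ge0// normrX.
rewrite lerXn2r ?nnegrE//.
rewrite [leRHS]/Num.norm /= mx_normrE; apply/bigmax_geP; right => /=.
by exists (ord0, i) => //=; rewrite !mxE.
Qed.

Let diam_gt0 : 0 < diam E.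
Proof.
rewrite lt_def diam_ge0 andbT; apply/eqP => /(hausdorff_diam0 d0) H0.
by have := HE0; rewrite H0 ltxx.
Qed.

(** The distance of two distinct points of [E] is a real radius to which regularity applies. *)
Let small_radius : exists2 r0 : R, (0 < r0)%R & r0%:E <= diam E.
Proof.
have [_ [->|[x [y [Ex Ey ->]]]]] := ereal_sup_gt diam_gt0;
  first by rewrite ltxx.
rewrite lte_fin => xy0; exists (eucl_dist x y) => //; exact: eucl_dist_le_diam.
Qed.

(** Finitely many balls of radius [r0] centred in [E] cover it, and regularity makes each trace
    finite. Interiors of balls supply the open cover. *)
Lemma hausdorff_ahlfors_compact_lty : hausdorff d E < +oo.
Proof.
have [r0 r00 r0E] := small_radius; have [C C0 HC] := arE.
pose B (x : 'rV[R]_n) : set 'rV[R]_n := (eucl_ball x r0)^°.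
have xB x : B x x.
  (* A sup-norm ball of this radius lies in the Euclidean one, since Euclidean distance is at most
     sqrt n times the sup norm; the added 1 keeps the denominator positive. *)
  apply/nbhs_ballP; exists (r0 / (Num.sqrt n%:R + 1))%R => /=.
    by rewrite divr_gt0// ltr_wpDl.
  move=> y; rewrite -ball_normE /= ltr_pdivlMr ?ltr_wpDl// => xy.
  apply: le_lt_trans (eucl_dist_le_norm _ _) _; apply: le_lt_trans xy.
  by rewrite mulrC ler_wpM2l// lerDl.
have := cE; rewrite compact_cover => /(_ _ E B) [i _|x Ex|D DE EB].
- exact: open_interior.
- by exists x.
have fin_cover (s : seq 'rV[R]_n) : (forall x, x \in s -> E x) ->
    hausdorff d (\big[setU/set0]_(x <- s) (eucl_ball x r0 `&` E)) < +oo.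
  elim: s => [_|x s ih sE]; first by rewrite big_nil hausdorff_set0.
  rewrite big_cons (le_lt_trans (hausdorff_setU_le d0 _ _))// lte_add_pinfty//.
    by rewrite (le_lt_trans (HC x r0 _ r00 r0E)) ?ltry//; apply: sE;
      rewrite mem_head.
  by apply: ih => y ys; apply: sE; rewrite inE ys orbT.
have {}fin_cover := fin_cover (finmap.enum_fset D) (fun x xD =>
  set_mem (DE x xD)).
apply: le_lt_trans fin_cover; apply: le_hausdorff => x Ex.
have [y yD Bxy] := EB _ Ex; rewrite -bigcup_fset; exists y => //.
by split=> //; exact: interior_subset Bxy.
Qed.

(** Regularity covers r <= r0. For r > r0 the whole mass [h] is at most (h / r0^d) r^d, hence the
    second term of the constant. *)
Lemma hausdorff_ball_le : exists2 C : R, (0 <= C)%R &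
  forall (x : 'rV[R]_n) r, E x -> (0 < r)%R ->
    hausdorff d (eucl_ball x r `&` E) <= (C * r `^ d)%:E.
Proof.
have [r0 r00 r0E] := small_radius; have [C C0 HC] := arE.
have Hfin : hausdorff d E \is a fin_num.
  by rewrite ge0_fin_numE ?hausdorff_ge0// hausdorff_ahlfors_compact_lty.
pose h := fine (hausdorff d E).
have h0 : (0 <= h)%R by rewrite fine_ge0// hausdorff_ge0.
exists (C + h / r0 `^ d)%R.
  by rewrite addr_ge0 ?divr_ge0 ?powR_ge0 ?(ltW C0).
move=> x r Ex r1; have [rr0|r0r] := leP r r0.
  rewrite (le_trans (HC x r Ex r1 _))//;
    first by rewrite (le_trans _ r0E)// lee_fin.
  by rewrite lee_fin ler_wpM2r ?powR_ge0// lerDl divr_ge0 ?powR_ge0.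
apply: (@le_trans _ _ (hausdorff d E)); first by apply: le_hausdorff => y [].
rewrite -(fineK Hfin) -/h lee_fin mulrDl -[leLHS]add0r lerD//.
  by rewrite mulr_ge0 ?powR_ge0// ltW.
rewrite mulrAC ler_pdivlMr ?powR_gt0// ler_wpM2l//.
by rewrite ge0_ler_powR ?nnegrE ?(ltW d0) ?ltW.
Qed.

Lemma hausdorff_set1 (x : 'rV[R]_n) : hausdorff d ([set x] : set
  (borelRn R n)) = 0.
Proof. by apply: hausdorff_diam0 => //; exact: (@diam_subset1 _ _ _ x). Qed.

End AhlforsRegularCompact.

(** Carrying [Efin] lets the finite-measure structure be attached to this restriction. *)
Definition restr_hausdorff (R : realType) (n : nat) (d : R) (d0 : (0 < d)%R)
    (E : set (borelRn R n)) (mE : measurable E) (Efin : hausdorff d E < +oo) :=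
  mrestr (hausdorff_measure d0) mE.

Section RestrHausdorff.
Context (R : realType) (n : nat) (d : R) (d0 : (0 < d)%R).
Context (E : set (borelRn R n)) (mE : measurable E)
  (Efin : hausdorff d E < +oo).

Let nu := restr_hausdorff d0 mE Efin.

HB.instance Definition _ := Measure.copy nu (mrestr (hausdorff_measure d0) mE).

Let nu_fin : fin_num_fun nu.
Proof.
apply: lty_fin_num_fun; apply: le_lt_trans Efin.
by apply: le_hausdorff => x [].
Qed.

HB.instance Definition _ := Measure_isFinite.Build _ _ _ nu nu_fin.

End RestrHausdorff.

(** * Reverse Fatou and the energy bound *)

Section LimEsup.
Context (R : realType).

Lemma limf_einf_ge (T : choiceType) (X : filteredType T) (f : X -> \bar R)
    (F : set (set X)) (V : set X) (a : \bar R) :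
  F V -> (forall p, V p -> a <= f p) -> a <= limf_einf f F.
Proof.
move=> FV Va; rewrite limf_einfE; apply: le_ereal_sup_tmp.
exists (ereal_inf (f @` V)); first by exists V.
by apply: le_ereal_inf_tmp => _ [p Vp <-]; exact: Va.
Qed.

(** Every [V] in [F] contains a tail of [u], so the supremum over [V] dominates a tail supremum. *)
Lemma limn_esup_comp_le (T : choiceType) (X : filteredType T) (f : X -> \bar R)
    (F : set (set X)) (u : nat -> X) :
  (forall V, F V -> \forall k \near \oo, V (u k)) ->
  limn_esup (f \o u) <= limf_esup f F.
Proof.
move=> uF; apply: le_ereal_inf_tmp => _ [V FV <-].
have [N _ NV] := uF V FV.
apply: (@le_trans _ _ (ereal_sup ((f \o u) @` [set k | (N <= k)%N]))).
  by apply: ereal_inf_lbound; exists [set k | (N <= k)%N] => //; exists N.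
apply: ereal_sup_le => _ [k /= Nk <-]; exists (u k) => //.
exact: NV.
Qed.

(* Reverse Fatou, applied to a sequence increasing to [a] along which the
   integrals would stay above [b]. *)
Lemma near_integral_lt_limf_esup d (T : measurableType d)
    (mu : {finite_measure set T -> \bar R}) (D : set T) (G : R -> T -> \bar R)
    (a C : R) (b : \bar R) :
  measurable D -> (forall p, measurable_fun D (G p)) ->
  (\forall p \near a^'-, forall x, D x -> 0 <= G p x <= C%:E) ->
  \int[mu]_(x in D) limf_esup (fun p => G p x) a^'- < b ->
  \forall p \near a^'-, \int[mu]_(x in D) G p x < b.
Proof.
move=> mD mG GC Jb; apply: contrapT => nGb.
have pick_p k : exists p, [/\ (a - k.+1%:R^-1 < p < a)%R,
    forall x, D x -> 0 <= G p x <= C%:E & b <= \int[mu]_(x in D) G p x].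
  apply: contrapT => nop; apply: nGb; near=> p.
  rewrite ltNge; apply/negP => bp; apply: nop; exists p; split=> //;
    last by near: p.
  apply/andP; split; last by near: p; exact: nbhs_left_lt.
  by near: p; apply: nbhs_left_gt; rewrite ltrBlDr ltrDl invr_gt0.
have [u uP] := choice pick_p.
pose g k x := G (u k) x.
have u_left V : a^'- V -> \forall k \near \oo, V (u k).
  move=> [e /= e0 eV]; near=> k; have [/andP[lo hi] _ _] := uP k.
  apply: eV => //=; rewrite gtr0_norm ?subr_gt0// ltrBlDr addrC -ltrBlDr.
  apply: le_lt_trans lo; rewrite lerB// ltW//.
  by near: k; exact: (near_infty_natSinv_lt (PosNum e0)).
have gC k x : D x -> 0 <= g k x <= C%:E by have [_ + _] := uP k; exact.
pose s k x := esups (g ^~ x) k.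
have mg k : measurable_fun D (g k) by exact: mG.
have gs k x : g k x <= s k x by apply: ereal_sup_ubound; exists k => //=.
have sC k x : D x -> s k x <= C%:E.
  by move=> Dx; apply: ge_ereal_sup => _ [j _ <-]; have /andP[] := gC j x Dx.
have s0 k x : D x -> 0 <= s k x.
  by move=> Dx; rewrite (le_trans _ (gs k x))//; have /andP[] := gC k x Dx.
(* The tail suprema [s k] decrease to the limsup and stay below [C], which is integrable as [mu] is
   finite. *)
have [_ _ int_s] : [/\ mu.-integrable D (fun x => limn_esup (g ^~ x)),
    [sequence \int[mu]_(x in D) `|s k x - limn_esup (g ^~ x)|]_k @ \oo --> 0 &
    [sequence \int[mu]_(x in D) s k x]_k @ \oo -->
      \int[mu]_(x in D) limn_esup (g ^~ x)].
  apply: (dominated_convergence mD (g := EFin \o cst C)).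
  - by move=> k; exact: measurable_fun_esups.
  - exact: measurable_fun_limn_esup.
  - by apply: aeW => x Dx; rewrite limn_esup_lim; exact: is_cvg_esups.
  - exact: finite_measure_integrable_cst.
  - by apply: aeW => x k Dx; rewrite gee0_abs ?s0//=; exact: sC.
have : b <= \int[mu]_(x in D) limn_esup (g ^~ x).
  rewrite -(cvg_lim _ int_s)//; apply: lime_ge.
    by apply/cvg_ex; eexists; exact: int_s.
  apply: nearW => k; have [_ _ bk] := uP k; apply: (le_trans bk).
  apply: ge0_le_integral_nonmeasurable => x Dx; last exact: gs.
  by have /andP[] := gC k x Dx.
apply/negP; rewrite -ltNge; apply: le_lt_trans Jb.
apply: ge0_le_integral_nonmeasurable => x Dx; last exact: limn_esup_comp_le.
rewrite limn_esup_lim; apply: lime_ge; first exact: is_cvg_esups.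
by apply: nearW => k; exact: s0.
Unshelve. all: by end_near. Qed.

End LimEsup.

Lemma riesz_energy_ge0 (R : realType) (n : nat) (p : R) (E : set
  (borelRn R n)) :
  0 <= riesz_energy p E.
Proof.
apply: le_ereal_inf_tmp => _ [mu muE <-].
apply: integral_ge0 => x _; apply: integral_ge0 => y _.
by rewrite /riesz_kernel; case: ifP => // _; rewrite lee_fin powR_ge0.
Qed.

(** The trial measure is [nu] divided by its mass [h]: one factor 1/h comes from its potential, the
    other from the outer integral, and the 1 is its total mass. *)
Lemma riesz_energy_le (R : realType) (n : nat) (p h : R) (E : set (borelRn R n))
    (nu : {finite_measure set (borelRn R n) -> \bar R}) :
  (0 < p)%R -> (0 < h)%R -> measurable E -> nu E = h%:E -> nu setT = h%:E ->
  (forall x, nu [set x] = 0) ->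
  riesz_energy p E <=
  1 + (p / h ^+ 2)%:E * \int[nu]_(x in E) truncated_potential nu p x.
Proof.
move=> p0 h0 mE nuE nuT nu1.
have hV0 : (0 <= h^-1)%R by rewrite invr_ge0 ltW.
have [mu muM] : exists mu : probability (borelRn R n) R,
    forall A, mu A = (h^-1)%:E * nu A.
  pose m := mscale (NngNum hV0) nu.
  have m1 : m setT = 1 by rewrite /m /mscale/= nuT -EFinM mulVf// gt_eqF.
  by exists (HB.pack_for (probability (borelRn R n) R) m
    (Measure_isProbability.Build _ _ _ m m1)).
have K0 x y : 0 <= riesz_kernel p x y :> \bar R.
  by rewrite /riesz_kernel; case: ifP => // _; rewrite lee_fin powR_ge0.
have phiM x : truncated_potential mu p x =
  (h^-1)%:E * truncated_potential nu p x.
  have mw : measurable_fun (`]0%R, 1%R[%classic : set (measurableTypeR R))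
      (fun r : measurableTypeR R => radial_weight nu p (x, r)).
    apply: measurable_funTS;
      apply: measurableT_comp (measurable_radial_weight nu p) _.
    exact: pair1_measurable.
  have w0 r : 0 <= radial_weight nu p (x, r) by exact: radial_weight_ge0.
  rewrite /truncated_potential -ge0_integralZl//.
  by apply: eq_integral => r _; rewrite /radial_weight muleA; congr (_ * _);
    exact: muM.
apply: (@le_trans _ _ (\int[mu]_(x in E) \int[mu]_(y in E) riesz_kernel p x y)).
  have muE : mu E = 1 by rewrite muM nuE -EFinM mulVf// gt_eqF.
  by apply: ereal_inf_lbound; exists mu.
have mphi := measurable_truncated_potential nu p.
have phi0 := truncated_potential_ge0 nu p.
apply: (@le_trans _ _ (\int[mu]_(x in E) (1 +
  (p / h)%:E * truncated_potential nu p x))).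
  apply: ge0_le_integral_nonmeasurable => x Ex.
    by apply: integral_ge0 => y _; exact: K0.
  apply: (@le_trans _ _ (\int[mu]_y riesz_kernel p x y)).
    rewrite integral_mkcond; apply: ge0_le_integral_nonmeasurable => y _.
      by apply: erestrict_ge0 => z _; exact: K0.
    by rewrite /patch; case: ifP.
  apply: le_trans (integral_riesz_kernel_le p0 _) _.
    by transitivity ((h^-1)%:E * nu [set x]); [exact: muM|rewrite nu1 mule0].
  have muT : mu setT = 1 by rewrite muM nuT -EFinM mulVf// gt_eqF.
  by rewrite phiM muleA -EFinM; apply: leeD2r; rewrite [leLHS]muT.
have -> : \int[mu]_(x in E) (1 + (p / h)%:E * truncated_potential nu p x) =
  (h^-1)%:E * \int[nu]_(x in E) (1 + (p / h)%:E * truncated_potential nu p x).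
  rewrite (eq_measure_integral (mscale (NngNum hV0) nu));
    last by move=> A _ _; exact: muM.
  rewrite (@ge0_integral_mscale _ _ _ nu _ mE (NngNum hV0))//.
    apply: emeasurable_funD; first exact: measurable_cst.
    by apply: emeasurable_funM; [exact: measurable_cst|exact: measurable_funTS].
  by move=> x _; rewrite adde_ge0// mule_ge0// lee_fin divr_ge0 ?ltW.
rewrite ge0_integralD//; last 2 first.
- by move=> x _; rewrite mule_ge0// lee_fin divr_ge0 ?ltW.
- by apply: emeasurable_funM; [exact: measurable_cst|exact: measurable_funTS].
rewrite integral_cst// mul1e [X in _ * (X + _)]nuE ge0_integralZl//;
  last 2 first.
- exact: measurable_funTS.
- by rewrite lee_fin divr_ge0 ?ltW.
rewrite ge0_muleDr//; last 2 first.
- by rewrite lee_fin ltW.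
- by rewrite mule_ge0 ?lee_fin ?divr_ge0 ?(ltW p0) ?(ltW h0)// integral_ge0.
rewrite -EFinM mulVf ?gt_eqF// muleA -EFinM.
by rewrite (_ : h^-1 * (p / h) = p / h ^+ 2)%R// expr2 invfM mulrCA mulrA.
Qed.

(** * From the energy bound to the limit of capacities *)

Lemma bound_gt0 (R : realType) (h d j e : R) :
  (0 < h)%R -> (0 < d)%R -> (0 <= j)%R -> (0 < e)%R ->
  (0 < e + d / h ^+ 2 * (j + e))%R.
Proof.
move=> h0 d0 j0 e0; apply: addr_gt0 => //; apply: mulr_gt0.
  by apply: divr_gt0 => //; exact: exprn_gt0.
by rewrite ltr_wpDl.
Qed.

(** Letting e tend to 0 gives 1 <= l (d / h^2) j, which also forces j > 0: a finite lower limit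
    excludes a zero denominator. *)
Lemma ler_div_of_le_add_eps (R : realType) (h d j l : R) :
  (0 < h)%R -> (0 < d)%R -> (0 <= j)%R ->
  (forall e, (0 < e)%R -> (1 <= l * (e + d / h ^+ 2 * (j + e)))%R) ->
  (0 < j)%R /\ (h ^+ 2 / d / j <= l)%R.
Proof.
move=> h0 d0 j0 H.
have c0 : (0 < d / h ^+ 2)%R by rewrite divr_gt0// exprn_gt0.
set c := (d / h ^+ 2)%R in H c0 *.
have l0 : (0 < l)%R.
  rewrite ltNge; apply/negP => l0; have := H _ ltr01; apply/negP;
    rewrite -ltNge.
  apply: le_lt_trans ltr01;
    rewrite mulr_le0_ge0// addr_ge0// mulr_ge0 ?(ltW c0)//.
  by rewrite addr_ge0.
have H1 : (1 <= l * (c * j))%R.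
  apply/ler_addgt0Pr => e e0.
  (* The hypothesis at e / (l (1 + c)) exceeds its limit l c j by exactly e. *)
  have c1 : (0 < l * (1 + c))%R by rewrite mulr_gt0// addr_gt0.
  have := H (e / (l * (1 + c)))%R (divr_gt0 e0 c1).
  have := divfK (lt0r_neq0 c1) e; set e' := (e / _)%R => <-.
  suff -> : (l * (e' + c * (j + e')) = l * (c * j) + e' * (l *
    (1 + c)))%R by [].
  by ring.
have j1 : (0 < j)%R.
  rewrite lt_def j0 andbT; apply/eqP => jE; move: H1.
  by rewrite jE !mulr0 ler10.
split=> //; rewrite ler_pdivrMr// ler_pdivrMr//.
have h2 : (0 < h ^+ 2)%R by rewrite exprn_gt0.
rewrite -[leLHS]mul1r; apply: le_trans (ler_wpM2r (ltW h2) H1) _.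
suff -> : (l * (c * j) * h ^+ 2 = l * j * d)%R by [].
by rewrite /c; field; rewrite gt_eqF.
Qed.

Lemma riesz_capacity_powerE (R : realType) (n : nat) (p : R)
    (E : set (borelRn R n)) : (0 < p)%R ->
  riesz_capacity p E `^ p = (riesz_energy p E)^-1.
Proof.
move=> p0; rewrite /riesz_capacity -poweRrM mulVf ?gt_eqF// poweRe1//.
by rewrite inve_ge0 riesz_energy_ge0.
Qed.

(** The first e absorbs (d - p) times the constant 1, the factor d replaces p < d, and j + e bounds
    the integral. *)
Lemma scaled_riesz_energy_le (R : realType) (n : nat) (p d e h j : R)
    (E : set (borelRn R n)) (nu : {finite_measure set
      (borelRn R n) -> \bar R}) :
  (0 < p)%R -> (p < d)%R -> (d - p < e)%R -> (0 < h)%R -> measurable E ->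
  nu E = h%:E -> nu setT = h%:E -> (forall x, nu [set x] = 0) ->
  \int[nu]_(x in E) ((d - p)%:E * truncated_potential nu p x) <= (j + e)%:E ->
  (d - p)%:E * riesz_energy p E <= (e + d / h ^+ 2 * (j + e))%:E.
Proof.
move=> p0 pd de h0 mE nuE nuT nu1 Ije.
have dp0 : 0 <= (d - p)%:E by rewrite lee_fin subr_ge0 ltW.
have c0 : 0 <= (p / h ^+ 2)%:E.
  by rewrite lee_fin; apply: divr_ge0; [exact: ltW|exact/exprn_ge0/ltW].
have phi0 (x : borelRn R n) := truncated_potential_ge0 nu p x.
apply: le_trans (lee_wpmul2l dp0 (riesz_energy_le p0 h0 mE nuE nuT nu1)) _.
rewrite ge0_muleDr; [|by []|by apply: mule_ge0 => //; exact: integral_ge0].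
rewrite mule1 [leRHS]EFinD; apply: leeD; first by rewrite lee_fin ltW.
rewrite muleCA -ge0_integralZl//; last first.
  by apply: measurable_funTS; exact: measurable_truncated_potential.
rewrite [leRHS]EFinM; apply: lee_pmul => //.
  by apply: integral_ge0 => x _; exact: mule_ge0.
by rewrite lee_fin ler_pM2r ?ltW// invr_gt0 exprn_gt0.
Qed.

(** V = 0 gives an infinite right side, and V = [+oo] contradicts the bound by [M]. *)
Lemma inve_scaled_le (R : realType) (V : \bar R) (t M : R) :
  (0 < t)%R -> (0 < M)%R -> 0 <= V -> t%:E * V <= M%:E ->
  (M^-1)%:E <= V^-1 / t%:E.
Proof.
move=> t0 M0; case: V => [v| |] // v0.
  rewrite -EFinM lee_fin => vM.
  have [->|vN0] := eqVneq v 0%R.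
    by rewrite inve0 inver gt_eqF// gt0_mulye ?leey// lte_fin invr_gt0.
  have vpos : (0 < v)%R by rewrite lt_def vN0.
  by rewrite !inver (negbTE vN0) gt_eqF//
    -EFinM lee_fin -invfM lef_pV2 ?posrE ?mulr_gt0// mulrC.
by rewrite gt0_muley ?lte_fin.
Qed.

(* 0^-1 = +oo in \bar R, so a zero denominator makes the bound +oo. *)
Theorem theorem1p5 (R : realType) (d : R) (n : nat) (E : set 'rV[R]_n) :
  (0 < d)%R -> (1 <= n)%N ->
  compact E -> upper_ahlfors_regular d E -> 0 < hausdorff d E ->
  hausdorff d E ^+ 2 / d%:E /
    \int[hausdorff (n:=n) d]_(x in E)
      upper_density2 d (set_restr (hausdorff d) E) x
  <= limf_einf (fun p : R => riesz_capacity p E `^ p / (d - p)%:E) d^'-.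
Proof.
move=> d0 _ cE arE HE0.
have Efin := hausdorff_ahlfors_compact_lty d0 cE arE HE0.
have mE : measurable (E : set (borelRn R n)).
  by apply: borel_closed; apply: compact_closed cE; exact: norm_hausdorff.
pose nu : {finite_measure set (borelRn R n) -> \bar R} :=
  restr_hausdorff d0 mE Efin.
have [C C0 HC] := hausdorff_ball_le d0 cE arE HE0.
pose h := fine (hausdorff d E).
have HE : hausdorff d E = h%:E by rewrite fineK// ge0_fin_numE// hausdorff_ge0.
have h0 : (0 < h)%R by rewrite -lte_fin -HE.
pose phi := truncated_potential nu.
pose G p x := (d - p)%:E * phi p x.
have nuE : nu E = h%:E by rewrite -HE; congr (hausdorff d _); exact: setIid.
have nuT : nu setT = h%:E by rewrite -HE; congr (hausdorff d _); exact: setTI.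
have nu1 (x : borelRn R n) : nu [set x] = 0.
  apply/eqP; rewrite eq_le measure_ge0 andbT -(hausdorff_set1 d0 x).
  by apply: le_hausdorff => y [].
have mG p : measurable_fun (E : set (borelRn R n)) (G p).
  apply: emeasurable_funM; first exact: measurable_cst.
  by apply: measurable_funTS; exact: measurable_truncated_potential.
have GC : \forall p \near d^'-, forall x, E x -> 0 <= G p x <= C%:E.
  near=> p => x Ex; have pd : (p < d)%R by near: p; exact: nbhs_left_lt.
  have dp0 : (0 < d - p)%R by rewrite subr_gt0.
  rewrite mule_ge0 ?lee_fin ?(ltW dp0) ?truncated_potential_ge0//=.
  have : phi p x <= (C / (d - p))%:E.
    apply: truncated_potential_le => // r /andP[r0 _]; exact: HC.
  move=> /(lee_wpmul2l (ltW dp0 : 0 <= (d - p)%:E)) /le_trans; apply.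
  by rewrite -EFinM mulrC divfK// gt_eqF.
set J := \int[_]_(_ in _) _.
(* [hausdorff d] and [nu] agree on subsets of [E], and [G] unfolds to the expression in
   [upper_density2] because [nu] of a ball is [set_restr] of it. *)
have JE : J = \int[nu]_(x in E) limf_esup (fun p => G p x) d^'-.
  rewrite /J; apply: (@eq_measure_integral _ _ _ _ nu (hausdorff_measure d0)).
  by move=> A _ AE; congr (hausdorff d _); apply/esym/setIidPl.
have near_pd : \forall p \near d^'-, (0 < p < d)%R.
  near=> p; apply/andP; split; near: p;
    [exact: nbhs_left_gt|exact: nbhs_left_lt].
have J0 : 0 <= J.
  rewrite JE; apply: integral_ge0 => x Ex;
    apply: le_ereal_inf_tmp => _ [V dV <-].
  have [p [Vp GCp]] := @filter_ex _ _ (at_left_proper_filter d) _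
    (filterI dV GC).
  have /andP[G0 _] := GCp x Ex; apply: le_trans G0 _.
  by apply: ereal_sup_ubound; exists p.
have cap0 p : (0 < p < d)%R -> 0 <= riesz_capacity p E `^ p / (d - p)%:E.
  move=> /andP[p0 pd]; apply: mule_ge0; first exact: poweR_ge0.
  by rewrite inve_ge0 lee_fin subr_ge0 ltW.
(* Here the left side is 0, as [+oo^-1 = 0], and nonnegativity of the quotients suffices. *)
have [Joo|Joo] := eqVneq J +oo.
  rewrite Joo invey mule0; exact: (limf_einf_ge near_pd cap0).
have Jfin : J \is a fin_num by rewrite (ge0_fin_numE J0) ltey; exact: Joo.
pose j := fine J; have Jj : J = j%:E := esym (fineK Jfin).
have j0 : (0 <= j)%R by rewrite -lee_fin -Jj.
set L := limf_einf _ _.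
have key e : (0 < e)%R -> ((e + d / h ^+ 2 * (j + e))^-1)%:E <= L.
  move=> e0; pose M := (e + d / h ^+ 2 * (j + e))%R.
  have M0 : (0 < M)%R := bound_gt0 h0 d0 j0 e0.
  have intG : \forall p \near d^'-, \int[nu]_(x in E) G p x < (j + e)%:E.
    apply: (near_integral_lt_limf_esup mE mG GC).
    by rewrite -JE Jj lte_fin ltrDl.
  have near_e : \forall p \near d^'-, (d - e < p)%R.
    by apply: nbhs_left_gt; rewrite ltrBlDr ltrDl.
  apply: (limf_einf_ge (filterI (filterI near_pd near_e) intG)).
  move=> p [[/andP[p0 pd] ep] Ip].
  have dp0 : (0 < d - p)%R by rewrite subr_gt0.
  rewrite (@riesz_capacity_powerE _ _ _ E p0).
  have VM : (d - p)%:E * riesz_energy p E <= M%:E.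
    by apply: (scaled_riesz_energy_le p0 pd _ h0 mE nuE nuT nu1 (ltW Ip));
      rewrite ltrBlDl -ltrBlDr.
  exact: (inve_scaled_le dp0 M0 (riesz_energy_ge0 p E) VM).
rewrite HE Jj.
(* [L = +oo] is immediate and [key] excludes [-oo]; for finite [L] the denominator is positive, so
   the inverses in [\bar R] are real ones. *)
case: L key => [l| |] key; last 2 first.
- by rewrite leey.
- by have := key 1%R ltr01.
have [j1 jl] : (0 < j)%R /\ (h ^+ 2 / d / j <= l)%R.
  apply: (ler_div_of_le_add_eps h0 d0 j0) => e e0.
  have M0 := bound_gt0 h0 d0 j0 e0.
  by have := key e e0; rewrite lee_fin -[leLHS]mul1r ler_pdivrMr.
by rewrite !inver !gt_eqF//= -EFin_expe -!EFinM lee_fin.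
Unshelve. all: by end_near. Qed.
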